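(* Let $k$ be an uncountable algebraically closed field and let $A$ be a just infinite $k$-algebra which is countably generated as a $k$-algebra. Then $A$ is stably just infinite.
   Context: All rings are associative unital algebras over a field. A $k$-algebra $A$ is called just infinite if $\dim_k(A)=\infty$ and every nonzero two-sided ideal of $A$ has finite codimension in $A$. A just infinite $k$-algebra $A$ is called stably just infinite if $A\otimes_k K$ is just infinite over $K$ for every field extension $K/k$. *)

(* Defs.v *)
From HB Require Import structures.
From mathcomp Require Import all_boot all_order all_algebra.
Set Implicit Arguments.
Unset Strict Implicit.
Unset Printing Implicit Defensive.
Import GRing.Theory.
Local Open Scope ring_scope.

Definition in_span (R : pzRingType) (V : lmodType R) (n : nat) (v : 'I_n -> V)
  (x : V) : Prop :=
  exists c : 'I_n -> R, x = \sum_(i < n) c i *: v i.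

Definition finite_dim (R : pzRingType) (V : lmodType R) : Prop :=
  exists n (v : 'I_n -> V), forall x : V, in_span v x.

Definition lin_indep (R : pzRingType) (V : lmodType R) (n : nat) (v : 'I_n -> V)
  : Prop :=
  forall c : 'I_n -> R, \sum_(i < n) c i *: v i = 0 -> forall i, c i = 0.

Definition two_sided_ideal (A : pzRingType) (I : A -> Prop) : Prop :=
  [/\ I 0, (forall x y, I x -> I y -> I (x + y)),
      (forall a x, I x -> I (a * x)) & (forall a x, I x -> I (x * a))].

Definition finite_codim (R : pzRingType) (V : lmodType R) (I : V -> Prop) : Prop :=
  exists n (v : 'I_n -> V), forall x : V,
    exists c : 'I_n -> R, I (x - \sum_(i < n) c i *: v i).

Definition just_infinite (k : fieldType) (A : algType k) : Prop :=
  ~ finite_dim A /\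
  forall I : A -> Prop, two_sided_ideal I -> (exists x, I x /\ x <> 0) ->
    finite_codim I.

Definition subalgebra (k : fieldType) (A : algType k) (S : A -> Prop) : Prop :=
  [/\ S 1, (forall x y, S x -> S y -> S (x + y)),
      (forall x y, S x -> S y -> S (x * y)) & (forall c x, S x -> S (c *: x))].

Definition countably_generated (k : fieldType) (A : algType k) : Prop :=
  exists g : nat -> A, forall S : A -> Prop, subalgebra S ->
    (forall n, S (g n)) -> forall x, S x.

(* (B, f) is the scalar extension A ⊗_k K of A along the field extension
   iota : k -> K: f is a k-algebra map (K acting through iota), its image
   spans B over K, and it maps k-independent families to K-independent ones;
   i.e. the induced K-algebra map A ⊗_k K -> B, a ⊗ c |-> c f(a), is bijective. *)
Definition is_scalar_extension (k K : fieldType) (iota : {rmorphism k -> K})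
  (A : algType k) (B : algType K) (f : {rmorphism A -> B}) : Prop :=
  [/\ (forall (c : k) (a : A), f (c *: a) = iota c *: f a),
      (forall b : B, exists n (c : 'I_n -> K) (a : 'I_n -> A),
          b = \sum_(i < n) c i *: f (a i)) &
      (forall n (a : 'I_n -> A), lin_indep a -> lin_indep (fun i => f (a i)))].

Definition stably_just_infinite (k : fieldType) (A : algType k) : Prop :=
  just_infinite A /\
  forall (K : fieldType) (iota : {rmorphism k -> K}) (B : algType K)
         (f : {rmorphism A -> B}),
    is_scalar_extension iota f -> just_infinite B.

(* Main.v *)
Require Import Defs.
From HB Require Import structures.
From mathcomp Require Import all_boot all_order all_algebra.
From mathcomp Require Import boolp classical_sets.

Set Implicit Arguments.
Unset Strict Implicit.
Unset Printing Implicit Defensive.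
Import GRing.Theory.
Local Open Scope ring_scope.

(* Suppose that a nonzero ideal J of B = A (x) K has infinite codimension, and
   pick 0 <> e = \sum_i c_i f(a_i) in J.  Let b_0, b_1, ... span A.  For each m
   there is a K-linear functional l_m on B that kills J and f(b_0), ...,
   f(b_(m-1)) but not all of f(A), and there is one, l_e, with l_e(e) = 1.  The
   k-subalgebra U of K generated by the c_i and all values of these functionals
   on the f(b_j) is countably generated, so, k being uncountable and
   algebraically closed, U has a k-algebra morphism phi to k.  Then
   w = \sum_i phi(c_i) a_i is nonzero because phi(l_e(f(w))) = phi(l_e(e)) = 1,
   and every phi o l_m o f kills the ideal A w A.  The m-th of them also kills
   b_0, ..., b_(m-1) and is nonzero, so A w A has infinite codimension in A. *)

(** * Maximal submodules and separating functionals *)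

Definition subring_pred (R : pzRingType) (U : R -> Prop) : Prop :=
  [/\ U 1, (forall x y, U x -> U y -> U (x - y)) &
      (forall x y, U x -> U y -> U (x * y))].

Definition submodule_over (R : pzRingType) (U : R -> Prop) (V : lmodType R)
  (M : V -> Prop) : Prop :=
  [/\ M 0, (forall x y, M x -> M y -> M (x - y)) &
      (forall c x, U c -> M x -> M (c *: x))].

(** Zorn's lemma, applied to the submodules that contain [P] and avoid [x]. It is used with [U] a
    whole field, to build functionals, and with [U] a subring of a commutative ring, for the
    Nullstellensatz. *)
Lemma maximal_submodule_avoiding (R : pzRingType) (U : R -> Prop)
    (V : lmodType R) (P : V -> Prop) (x : V) :
  subring_pred U -> submodule_over U P -> ~ P x ->
  exists M : V -> Prop, [/\ submodule_over U M, (forall v, P v -> M v), ~ M x &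
    forall y, ~ M y -> exists2 c, U c & M (x - c *: y)].
Proof.
move=> [U1 UB UM] subP Px.
(* The empty set is admitted because the union of the empty chain is empty. *)
pose Q : set (set V) := [set M | M = set0 \/
  [/\ submodule_over U M, (forall v, P v -> M v) & ~ M x]]%classic.
have [F subF totF|M [QM maxM]] := @Zorn_bigcup V Q.
  have [[Y FY [v0 Yv0]]|allF0] := pselect (exists2 Y, F Y & exists v, Y v);
    last first.
    left; apply/seteqP; split=> // v [Y FY Yv]; apply: allF0.
    by exists Y => //; exists v.
  have nonempty Z v : F Z -> Z v ->
      [/\ submodule_over U Z, (forall v, P v -> Z v) & ~ Z x].
    by move=> FZ Zv; case: (subF _ FZ) => // Z0; rewrite Z0 in Zv.
  right; have [[Y0 YB YZ] PY Yx] := nonempty _ _ FY Yv0.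
  split; last 2 first.
  - by move=> v Pv; exists Y => //; apply: PY.
  - by move=> [Z FZ Zx]; case: (nonempty _ _ FZ Zx).
  split; first by exists Y.
  - move=> u v [Z FZ Zu] [W FW Wv].
    have [[_ ZB _] _ _] := nonempty _ _ FZ Zu.
    have [[_ WB _] _ _] := nonempty _ _ FW Wv.
    case: (totF _ _ FZ FW) => sub.
      by exists W => //; apply: WB => //; apply: sub.
    by exists Z => //; apply: ZB => //; apply: sub.
  - move=> c u Uc [Z FZ Zu]; have [[_ _ ZZ] _ _] := nonempty _ _ FZ Zu.
    by exists Z => //; apply: ZZ.
have {QM} [M0|[subM PM Mx]] := QM.
  case: (maxM P); last by right.
  by rewrite M0; split => // PS; case: subP => /PS.
exists M; split=> // y My; apply: contrapT => Nx.
have [M0 MB MZ] := subM.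
have U0 : U 0 by rewrite -(subrr 1); apply: UB.
(* [N] is M + U y. It contains [y], so it is strictly larger than [M], and [Nx] says precisely that
   it avoids [x]. *)
pose N v := exists2 c, U c & M (v - c *: y).
have subMN v : M v -> N v by exists 0 => //; rewrite scale0r subr0.
case: (maxM N).
  split=> // NM; apply/My/NM.
  by exists 1 => //; rewrite scale1r subrr.
right; split=> //; last by move=> v /PM /subMN.
split; first exact: subMN.
- move=> u v [c Uc Mu] [d Ud Mv]; exists (c - d); first exact: UB.
  have -> : u - v - (c - d) *: y = (u - c *: y) - (v - d *: y).
    by rewrite scalerBl !opprB [d *: y - _]addrC addrACA [- v + _]addrC.
  exact: MB.
- move=> c u Uc [d Ud Mu]; exists (c * d); first exact: UM.
  by rewrite -scalerA -scalerBr; apply: MZ.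
Qed.

(** Over a field, a maximal [M] avoiding [x] is a hyperplane with complement K x; [l] is the
    coordinate along [x]. *)
Lemma separating_functional (K : fieldType) (V : lmodType K) (P : V -> Prop)
    (x : V) :
  submodule_over (fun=> True) P -> ~ P x ->
  exists l : {scalar V}, (forall v, P v -> l v = 0) /\ l x = 1.
Proof.
move=> subP Px.
have [|M [[M0 MB MZ] PM Mx maxM]] := maximal_submodule_avoiding _ subP Px.
  by [].
have MN v : M v -> M (- v) by move=> Mv; rewrite -sub0r; apply: MB.
have MD u v : M u -> M v -> M (u + v).
  by move=> Mu Mv; rewrite -[v]opprK; apply/MB/MN.
have split_x y : exists c, M (y - c *: x).
  have [My|/maxM[c _ Mc]] := pselect (M y).
    by exists 0; rewrite scale0r subr0.
  have c0 : c != 0.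
    apply: contra_notN Mx => /eqP c0.
    by rewrite c0 scale0r subr0 in Mc.
  exists c^-1; have /MN := MZ c^-1 _ I Mc.
  by rewrite scalerBr scalerA mulVf // scale1r opprB.
have [l lP] := choice split_x.
have l_unique y c : M (y - c *: x) -> l y = c.
  move=> Mc; apply/eqP; rewrite -subr_eq0; apply: contra_notT Mx => d0.
  have := MB _ _ Mc (lP y); rewrite opprB addrC addrA subrK -scalerBl.
  by move=> /(MZ (l y - c)^-1 _ I); rewrite scalerA mulVf // scale1r.
have l_lin : scalar l.
  move=> a u v; apply: l_unique.
  have -> : a *: u + v - (a * l u + l v) *: x
      = a *: (u - l u *: x) + (v - l v *: x).
    by rewrite scalerDl scalerBr scalerA opprD addrACA.
  by apply: MD => //; apply: MZ.
pose lL : {scalar V} := HB.pack l (GRing.isLinear.Build _ _ _ _ l l_lin).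
exists lL; split=> [v /PM Mv|]; apply: l_unique.
  by rewrite scale0r subr0.
by rewrite scale1r subrr.
Qed.

(** * Subrings of countable dimension *)

(** Scalars act by multiplication through [iota], so that one notion serves both for a field
    extension and, with [in_alg], for an algebra. *)
Definition span_below (k R : pzRingType) (iota : k -> R) (s : nat -> R)
  (n : nat) (x : R) : Prop :=
  exists c : nat -> k, x = \sum_(i < n) iota (c i) * s i.

Definition countable_span (k R : pzRingType) (iota : k -> R) (s : nat -> R)
  (x : R) : Prop := exists n, span_below iota s n x.

Lemma span_below_widen (k R : pzRingType) (iota : {rmorphism k -> R})
    (s : nat -> R) m n x :
  (m <= n)%N -> span_below iota s m x -> span_below iota s n x.
Proof.
move=> le_mn [c ->]; exists (fun i => if (i < m)%N then c i else 0).
rewrite (big_ord_widen n (fun i => iota (c i) * s i)) // big_mkcond.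
by apply: eq_bigr => i _; case: ifP => _ //; rewrite rmorph0 mul0r.
Qed.

Lemma countable_spanD (k R : pzRingType) (iota : {rmorphism k -> R})
    (s : nat -> R) x y :
  countable_span iota s x -> countable_span iota s y ->
  countable_span iota s (x + y).
Proof.
move=> [m xm] [n yn]; exists (maxn m n).
have [c ->] := span_below_widen (leq_maxl m n) xm.
have [d ->] := span_below_widen (leq_maxr m n) yn.
exists (fun i => c i + d i); rewrite -big_split.
by apply: eq_bigr => i _; rewrite rmorphD mulrDl.
Qed.

Lemma countable_spanZ (k R : pzRingType) (iota : {rmorphism k -> R})
    (s : nat -> R) a x :
  countable_span iota s x -> countable_span iota s (iota a * x).
Proof.
move=> [n [c ->]]; exists n, (fun i => a * c i).
by rewrite mulr_sumr; apply: eq_bigr => i _; rewrite rmorphM mulrA.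
Qed.

Lemma countable_span_sum (k R : pzRingType) (iota : {rmorphism k -> R})
    (s : nat -> R) n (F : 'I_n -> R) :
  (forall i, countable_span iota s (F i)) ->
  countable_span iota s (\sum_(i < n) F i).
Proof.
move=> sF; apply: (big_ind (countable_span iota s)) => //.
  by exists 0, (fun=> 0); rewrite big_ord0.
by move=> x y; apply: countable_spanD.
Qed.

Lemma mem_countable_span (k R : pzRingType) (iota : {rmorphism k -> R})
    (s : nat -> R) i :
  countable_span iota s (s i).
Proof.
exists i.+1, (fun j => (j == i)%:R); rewrite big_ord_recr /= eqxx rmorph1 mul1r.
rewrite big1 ?add0r // => j _; rewrite (ltn_eqF (ltn_ord j)).
by rewrite rmorph0 mul0r.
Qed.

(** The words in a countable alphabet are countable, and as scalars are central, the span of the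
    corresponding monomials is closed under products. *)
Lemma countably_generated_subring (k R : pzRingType)
    (iota : {rmorphism k -> R}) (I : countType) (g : I -> R) :
  (forall c x, iota c * x = x * iota c) ->
  exists s : nat -> R, let U := countable_span iota s in
    [/\ subring_pred U, (forall c, U (iota c)) & (forall i, U (g i))].
Proof.
move=> central.
pose monomial (w : seq I) := \prod_(i <- w) g i.
pose s n := oapp monomial 0 (unpickle n).
exists s => U.
have Umon w : U (monomial w).
  have -> : monomial w = s (pickle w) by rewrite /s pickleK.
  exact: mem_countable_span.
have U1 : U 1 by have := Umon [::]; rewrite /monomial big_nil.
have Us i j : U (s i * s j).
  have U0 : U 0 by exists 0, (fun=> 0); rewrite big_ord0.
  have sP n : s n = 0 \/ exists w, s n = monomial w.
    by rewrite /s; case: (unpickle n) => [w|]; [right; exists w|left].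
  case: (sP i) => [->|[w ->]]; first by rewrite mul0r.
  case: (sP j) => [->|[w' ->]]; first by rewrite mulr0.
  by rewrite /monomial -big_cat; apply: Umon.
split; last 2 first.
- by move=> c; rewrite -[iota c]mulr1; apply: countable_spanZ.
- by move=> i; have := Umon [:: i]; rewrite /monomial big_seq1.
split=> // x y Ux Uy.
  apply: countable_spanD => //; rewrite -mulN1r -(rmorph1 iota) -rmorphN.
  exact: countable_spanZ.
move: Ux Uy => [m [c ->]] [n [d ->]]; rewrite mulr_suml.
apply: countable_span_sum => i; rewrite mulr_sumr.
apply: countable_span_sum => j; rewrite -mulrA; apply: countable_spanZ.
by rewrite mulrA -central -mulrA; apply: countable_spanZ; apply: Us.
Qed.

(** * A Nullstellensatz in countable dimension *)

Lemma uniq_seq_or_covered (T : eqType) (P : T -> Prop) m :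
  (exists s, [/\ uniq s, size s = m & forall x, x \in s -> P x]) \/
  (exists s : seq T, forall x, P x -> x \in s).
Proof.
elim: m => [|m [[s [us ss Ps]]|]]; [by left; exists [::] | | by right].
have [cov|/existsNP[x /not_implyP[Px xs]]] :=
  pselect (forall x, P x -> x \in s).
  by right; exists s.
left; exists (x :: s); split=> /=.
- by rewrite us andbT; apply/negP.
- by rewrite ss.
- by move=> y; rewrite inE => /orP[/eqP->|/Ps].
Qed.

(** Otherwise each fiber is covered by a finite list, and the pairs (fiber, position in its list)
    enumerate [T]. *)
Lemma uncountable_fiber (T : eqType) (x0 : T) (Q : nat -> T -> Prop) :
  ~ (exists e : nat -> T, forall x, exists n, e n = x) ->
  (forall t, exists n, Q n t) ->
  exists n, forall m,
    exists s, [/\ uniq s, size s = m & forall x, x \in s -> Q n x].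
Proof.
move=> uncountable QT; apply: contrapT => /forallNP small.
have /choice[r rP] n : exists s : seq T, forall x, Q n x -> x \in s.
  have /existsNP[m few] := small n.
  by have [|] := uniq_seq_or_covered (Q n) m.
apply: uncountable.
exists (fun p => if unpickle p is Some (n, i) then nth x0 (r n) i else x0) => x.
have [n /rP xr] := QT x; exists (pickle (n, index x (r n))).
by rewrite pickleK nth_index.
Qed.

(** The coefficient matrix has more rows than columns, hence a nonzero left kernel. *)
Lemma linear_relation (R : nzRingType) (F : fieldType)
    (iota : {rmorphism F -> R}) (s : nat -> R) n (v : 'I_n.+1 -> R) :
  (forall i, span_below iota s n (v i)) ->
  exists2 a : 'I_n.+1 -> F, (exists i, a i != 0) &
    \sum_i iota (a i) * v i = 0.
Proof.
move=> /choice[c vE].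
pose X := \matrix_(i < n.+1, j < n) c i j.
have : kermx X != 0.
  by rewrite kermx_eq0 -row_leq_rank -ltnNge ltnS rank_leq_col.
move=> /rowV0Pn[a /sub_kermxP aX /rV0Pn[i ai]].
exists (a 0) => [|{i ai}]; first by exists i.
under eq_bigr => i _ do rewrite vE mulr_sumr.
rewrite exchange_big big1 // => j _.
under eq_bigr do rewrite mulrA -rmorphM.
rewrite -mulr_suml -rmorph_sum.
have /matrixP/(_ 0 j) := aX; rewrite !mxE => aXj.
rewrite (eq_bigr (fun i => a 0 i * X i j)) => [|i _]; last by rewrite mxE.
by rewrite aXj rmorph0 mul0r.
Qed.

(* For a maximal U-submodule M of R avoiding 1, if y in U had no value modulo M
   then every y - t would be invertible modulo M; uncountably many inverses lie
   in a space of countable dimension, and a linear relation between them is a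
   polynomial relation for y, which splits over k. *)
Lemma countable_nullstellensatz (k : closedFieldType) (R : comNzRingType)
    (iota : {rmorphism k -> R}) (s : nat -> R) :
  let U := countable_span iota s in
  ~ (exists e : nat -> k, forall x : k, exists n, e n = x) ->
  subring_pred U -> (forall c, U (iota c)) ->
  exists phi : R -> k, [/\ forall c, phi (iota c) = c,
    forall x y, U x -> U y -> phi (x + y) = phi x + phi y &
    forall x y, U x -> U y -> phi (x * y) = phi x * phi y].
Proof.
move=> U uncountable subU Uk; have [U1 UB UM] := subU.
(* [M] is stable only under multiplication by [U], so every multiplier below has to be shown to lie
   in [U]. *)
have [| |M [[M0 MB MZ] _ M1 maxM]] :=
  @maximal_submodule_avoiding R U R^o (fun x => x = 0) 1 subU.
- split=> // [x y -> ->|c x _ ->]; first by rewrite subr0.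
  by rewrite scaler0.
- exact/eqP/oner_neq0.
have {}MZ u x : U u -> M x -> M (u * x) := MZ u x.
have MN x : M x -> M (- x) by move=> Mx; rewrite -sub0r; apply: MB.
have MD x y : M x -> M y -> M (x + y).
  by move=> Mx My; rewrite -[y]opprK; apply/MB/MN.
have value y : U y -> exists t, M (y - iota t).
  move=> Uy; apply: contrapT => /forallNP noval.
  have /choice[u uP] t : exists u, U u /\ M (1 - u * (y - iota t)).
    by have [u Uu Mu] := maxM _ (noval t); exists u.
  have cancel t x : U x -> M ((y - iota t) * x) -> M x.
    move=> Ux; case: (uP t) => Ut Mt /(MZ _ _ Ut) Mx.
    have := MD _ _ (MZ _ _ Ux Mt) Mx.
    by rewrite mulrBr mulr1 [x * _]mulrC -!mulrA subrK.
  have Uprod (I : Type) (r : seq I) (P : pred I) (t : I -> k) :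
      U (\prod_(i <- r | P i) (y - iota (t i))).
    by apply: big_ind => // i _; apply: UB.
  (* For some [n], infinitely many [t] have [u t] in the span of the first [n] terms of [s]; [n.+1]
     of them force a relation. *)
  have [n many] := uncountable_fiber 0 uncountable (fun t => (uP t).1).
  have [ts [uts size_ts uts_n]] := many n.+1.
  pose t (i : 'I_n.+1) := nth 0 ts i.
  have t_inj : injective t.
    by move=> i j /eqP; rewrite nth_uniq ?size_ts // => /eqP/val_inj.
  have /linear_relation[a [i0 ai0] a_rel] i : span_below iota s n (u (t i)).
    by apply: uts_n; rewrite mem_nth // size_ts.
  (* This is the relation between the inverses of the y - t_i with denominators cleared. At t_i0
     only the term of index [i0] survives, which shows that [F] is nonzero. *)
  pose F := \sum_i a i *: \prod_(j | j != i) ('X - (t j)%:P).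
  have F0 : F != 0.
    apply: contraNneq ai0 => F0; have := congr1 (horner^~ (t i0)) F0.
    rewrite horner0 horner_sum (bigD1 i0) //=.
    rewrite [X in _ + X]big1 ?addr0 => [|i ii0].
      rewrite hornerZ horner_prod => /eqP; rewrite mulf_eq0 => /orP[//|].
      move=> /prodf_eq0[j ji0]; rewrite hornerXsubC subr_eq0 => /eqP/t_inj ij.
      by rewrite ij eqxx in ji0.
    rewrite hornerZ horner_prod (bigD1 i0) 1?eq_sym //= hornerXsubC subrr.
    by rewrite mul0r mulr0.
  have cy : commr_rmorph iota y by move=> c; apply: mulrC.
  pose ev : {rmorphism {poly k} -> R} := horner_morph cy.
  have evXC c : ev ('X - c%:P) = y - iota c.
    by rewrite rmorphB /= horner_morphX horner_morphC.
  have evZ c p : ev (c *: p) = iota c * ev p.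
    by rewrite -mul_polyC rmorphM /= horner_morphC.
  have FM : M (ev F).
    pose G i := iota (a i) * \prod_(j | j != i) (y - iota (t j)).
    have -> : ev F = \sum_i G i.
      rewrite rmorph_sum; apply: eq_bigr => i _; rewrite /= evZ rmorph_prod.
      by congr (_ * _); apply: eq_bigr => j _; apply: evXC.
    (* The subtracted terms add up to the relation [a_rel] times the product of all y - t_j, hence
       to 0. *)
    have -> : \sum_i G i = \sum_i G i * (1 - u (t i) * (y - iota (t i))).
      rewrite -[LHS]subr0; under [RHS]eq_bigr do rewrite mulrBr mulr1.
      rewrite sumrB; congr (_ - _).
      rewrite -[LHS](mul0r (\prod_j (y - iota (t j)))) -{1}a_rel mulr_suml.
      apply: eq_bigr => i _; rewrite [in LHS](bigD1 i) //= /G.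
      by rewrite -!mulrA; congr (_ * _); rewrite [RHS]mulrC -mulrA.
    apply: (big_ind (M : R -> Prop)) => // i _; apply: MZ; last exact: (uP _).2.
    by apply: UM.
  (* [F] splits over [k]; [cancel] strips the linear factors one by one until 1 lies in [M]. *)
  have [r FE] := closed_field_poly_normal F.
  have lc0 : lead_coef F != 0 by rewrite lead_coef_eq0.
  have Mprod : M (\prod_(z <- r) (y - iota z)).
    have := MZ _ _ (Uk (lead_coef F)^-1) FM.
    rewrite {2}FE evZ mulrA -rmorphM mulVf // rmorph1 mul1r rmorph_prod.
    by under eq_bigr do rewrite evXC.
  apply: M1; elim: r Mprod {FE} => [|z r IHr]; first by rewrite big_nil.
  by rewrite big_cons => /cancel/IHr; apply.
have /choice[phi phiP] y : exists t, U y -> M (y - iota t).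
  have [/value[t Mt]|Uy] := pselect (U y); first by exists t.
  by exists 0.
have phi_unique y t : U y -> M (y - iota t) -> phi y = t.
  move=> Uy Mt; apply/eqP; rewrite -subr_eq0; apply: contra_notT M1 => d0.
  have := MB _ _ Mt (phiP _ Uy); rewrite opprB addrC addrA subrK -rmorphB.
  by move=> /(MZ _ _ (Uk (phi y - t)^-1)); rewrite -rmorphM mulVf // rmorph1.
exists phi; split=> [c|x y Ux Uy|x y Ux Uy]; apply: phi_unique => //.
- by rewrite subrr.
- exact: countable_spanD.
- by rewrite rmorphD opprD addrACA; apply: MD; apply: phiP.
- exact: UM.
have -> : x * y - iota (phi x * phi y)
    = y * (x - iota (phi x)) + iota (phi x) * (y - iota (phi y)).
  by rewrite rmorphM !mulrBr addrA [y * x]mulrC [y * iota _]mulrC subrK.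
by apply: MD; apply: MZ => //; apply: phiP.
Qed.

(** * Dimension and countable spanning sets *)

Lemma lin_indep_of_infinite_dim (k : fieldType) (V : lmodType k) :
  ~ finite_dim V -> forall n, exists v : 'I_n -> V, lin_indep v.
Proof.
move=> infV; elim=> [|n [v v_free]]; first by exists (fun=> 0) => c _ [].
have [x xP] : exists x, ~ in_span v x.
  by apply/existsNP => spanv; apply: infV; exists n, v.
exists (fun i => oapp v x (unlift ord0 i)) => c.
rewrite big_ord_recl unlift_none /=.
under eq_bigr do rewrite liftK /=.
have [c0|c0] := eqVneq (c ord0) 0.
  rewrite c0 scale0r add0r => /v_free c_lift i.
  by case: (unliftP ord0 i) => [j ->|->]; [apply: c_lift|].
move=> /eqP; rewrite addr_eq0 => /eqP cx; case: xP.
exists (fun i => - ((c ord0)^-1 * c (lift ord0 i))).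
rewrite -[LHS]scale1r -(mulVf c0) -scalerA cx scalerN scaler_sumr -sumrN.
by apply: eq_bigr => i _; rewrite scaleNr scalerA.
Qed.

(** An independent family of [n.+1] elements of [A] stays independent in [B], where [n] spanning
    vectors would force a relation. *)
Lemma scalar_extension_infinite_dim (k K : fieldType)
    (iota : {rmorphism k -> K}) (A : algType k) (B : algType K)
    (f : {rmorphism A -> B}) :
  is_scalar_extension iota f -> ~ finite_dim A -> ~ finite_dim B.
Proof.
move=> [_ _ f_free] infA [n [v vP]].
have [a /f_free fa_free] := lin_indep_of_infinite_dim infA n.+1.
pose s j := oapp v 0 (insub j).
have spanfa i : span_below (in_alg B) s n (f (a i)).
  have [c ->] := vP (f (a i)); exists (fun j => oapp c 0 (insub j)).
  by apply: eq_bigr => j _; rewrite /s valK /= mulr_algl.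
have [c [i /eqP ci] c_rel] := linear_relation spanfa.
apply/ci/fa_free; rewrite -[RHS]c_rel.
by apply: eq_bigr => j _; rewrite /= mulr_algl.
Qed.

Lemma countably_spanned (k : fieldType) (A : algType k) :
  countably_generated A ->
  exists s : nat -> A, forall x, countable_span (in_alg A) s x.
Proof.
move=> [g gP]; have [|s [[U1 UB UM] Uk Ug]] :=
  @countably_generated_subring k A (in_alg A) nat g.
  by move=> c x; rewrite /= mulr_algl mulr_algr.
exists s; apply: gP => //; split=> //.
- by move=> x y; apply: countable_spanD.
- move=> c x Ux; rewrite -mulr_algl.
  exact: (countable_spanZ (iota := in_alg A)).
Qed.

(** * Specialization of an ideal of infinite codimension *)

Lemma scalar_extension_finite_codim (k : closedFieldType) (K : fieldType)
    (iota : {rmorphism k -> K}) (A : algType k) (B : algType K)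
    (f : {rmorphism A -> B}) (J : B -> Prop) :
  ~ (exists e : nat -> k, forall x : k, exists n, e n = x) ->
  just_infinite A -> countably_generated A -> is_scalar_extension iota f ->
  two_sided_ideal J -> (exists x, J x /\ x <> 0) -> finite_codim J.
Proof.
move=> uncountable [_ jiA] /countably_spanned[b bP] [fZ f_span _].
move=> [J0 JD JL JR] [e [Je e0]]; apply: contrapT => infJ.
have JZ (c : K) x : J x -> J (c *: x).
  by move=> Jx; rewrite -mulr_algl; apply: JL.
have JB x y : J x -> J y -> J (x - y).
  by move=> Jx Jy; apply: JD => //; rewrite -scaleN1r; apply: JZ.
have [|l_e [_ l_e1]] := separating_functional (P := fun v => v = 0) _ e0.
  by split=> // [x y -> ->|c x _ ->]; rewrite ?subr0 ?scaler0.
pose W m x := exists c : 'I_m -> K, J (x - \sum_(i < m) c i *: f (b i)).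
have subW m : submodule_over (fun=> True) (W m).
  split.
  - by exists (fun=> 0); rewrite big1 ?subr0 // => i _; rewrite scale0r.
  - move=> x y [c Jx] [d Jy]; exists (fun i => c i - d i).
    under eq_bigr do rewrite scalerBl.
    rewrite sumrB opprB [X in _ + X]addrC addrACA [- y + _]addrC.
    by rewrite -[X in _ + X]opprB; apply: JB.
  - move=> c x _ [d Jx]; exists (fun i => c * d i).
    under eq_bigr do rewrite -scalerA.
    by rewrite -scaler_sumr -scalerBr; apply: JZ.
have JW m x : J x -> W m x.
  by exists (fun=> 0); rewrite big1 ?subr0 // => i _; rewrite scale0r.
have bW m i : (i < m)%N -> W m (f (b i)).
  move=> im; exists (fun j => (j == Ordinal im)%:R).
  rewrite (bigD1 (Ordinal im)) //= eqxx scale1r big1 ?addr0 ?subrr //.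
  by move=> j /negPf->; rewrite scale0r.
have /choice[l lP] m : exists l : {scalar B}, [/\ forall v, J v -> l v = 0,
    forall i, (i < m)%N -> l (f (b i)) = 0 & exists a, l (f a) = 1].
  (* The image of [f] spans [B], so if [W m] contained it, [J] would have finite codimension. *)
  have [a Wa] : exists a, ~ W m (f a).
    apply/existsNP => allW; apply: infJ.
    exists m, (fun i : 'I_m => f (b i)) => x.
    have [W0 WB WZ] := subW m; have [n [c [a ->]]] := f_span x.
    change (W m (\sum_(i < n) c i *: f (a i))).
    apply: big_ind => [//|u v Wu Wv|i _]; last exact: WZ.
    by rewrite -[v]opprK; apply: (WB) => //; rewrite -sub0r; apply: WB.
  have [l [lW l1]] := separating_functional (subW m) Wa.
  exists l; split=> [v /JW/lW//|i /bW/lW//|]; by exists a.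
have [n [c [a eE]]] := f_span e.
(* Index 0 is reserved for [l_e], which does not kill [J]; the functionals that do start at index
   1. *)
pose L m := if m is m'.+1 then l m' else l_e.
pose g (i : nat * nat + 'I_n) :=
  match i with inl mj => L mj.1 (f (b mj.2)) | inr i => c i end.
have [|s [subU Uk Ug]] := countably_generated_subring (iota := iota) g.
  by move=> ? ?; rewrite mulrC.
have [phi [phik phiD phiM]] := countable_nullstellensatz uncountable subU Uk.
have UL m x : countable_span iota s (L m (f x)).
  have [p [d ->]] := bP x; rewrite rmorph_sum linear_sum.
  apply: countable_span_sum => i; rewrite /= mulr_algl fZ linearZ /=.
  by apply: countable_spanZ; apply: (Ug (inl (m, _))).
pose psi m x := phi (L m (f x)).
have psiD m x y : psi m (x + y) = psi m x + psi m y.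
  by rewrite /psi rmorphD raddfD; apply: phiD; apply: UL.
have psiZ m (t : k) x : psi m (t *: x) = t * psi m x.
  by rewrite /psi fZ linearZ /= phiM // phik.
have phi_sum q (F : 'I_q -> K) : (forall i, countable_span iota s (F i)) ->
    phi (\sum_i F i) = \sum_i phi (F i).
  elim: q F => [|q IHq] F UF.
    by rewrite !big_ord0 -(rmorph0 iota) phik.
  rewrite !big_ord_recl phiD // ?IHq //; exact: countable_span_sum.
have psi_lin m q (t : 'I_q -> k) (v : 'I_q -> A) :
    psi m (\sum_i t i *: v i) = \sum_i t i * psi m (v i).
  rewrite /psi !raddf_sum phi_sum => [|i]; last exact: UL.
  by apply: eq_bigr => i _; apply: psiZ.
pose w := \sum_i phi (c i) *: a i.
(* The c_i and the values of [L m] on the image of [f] lie in [U], where [phi] is multiplicative, so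
   specializing [e] to [w] commutes with the functionals. *)
have psi_w m x y : psi m (x * w * y) = phi (L m (f x * e * f y)).
  have -> : x * w * y = \sum_i phi (c i) *: (x * a i * y).
    rewrite mulr_sumr mulr_suml; apply: eq_bigr => i _.
    by rewrite -scalerAr -scalerAl.
  have Uc i : countable_span iota s (c i) := Ug (inr i).
  rewrite psi_lin eE mulr_sumr mulr_suml linear_sum phi_sum => [|i].
    apply: eq_bigr => i _; rewrite -scalerAr -scalerAl linearZ /= phiM //.
      by rewrite -!rmorphM.
    by rewrite -!rmorphM.
  rewrite -scalerAr -scalerAl linearZ /= -!rmorphM.
  by case: subU => _ _; apply.
(* The largest two-sided ideal killed by every [psi m.+1]; it contains A w A. *)
pose I x := forall m y z, psi m.+1 (y * x * z) = 0.
have psi0 m : psi m 0 = 0 by rewrite -(scale0r 0) psiZ mul0r.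
have I_ideal : two_sided_ideal I.
  split.
  - by move=> m y z; rewrite mulr0 mul0r.
  - by move=> x y Ix Iy m u v; rewrite mulrDr mulrDl psiD Ix Iy addr0.
  - by move=> x y Iy m u v; rewrite mulrA.
  - by move=> x y Iy m u v; rewrite mulrA -mulrA.
have Iw : I w.
  move=> m y z; rewrite psi_w /=; have [lJ _ _] := lP m.
  by rewrite lJ -1?(rmorph0 iota) ?phik //; apply/JR/JL.
have w0 : w <> 0.
  have := psi_w 0 1 1; rewrite !mul1r !mulr1 rmorph1 mul1r mulr1 /= l_e1.
  move=> /[swap] ->; rewrite psi0 -(rmorph1 iota) phik => /eqP.
  by rewrite eq_sym oner_eq0.
have [q [v vP]] := jiA I I_ideal (ex_intro _ w (conj Iw w0)).
have psi_b m i : (i < m)%N -> psi m.+1 (b i) = 0.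
  by case: (lP m) => _ lb _ im; rewrite /psi /= lb // -(rmorph0 iota) phik.
(* The finitely many [v i] lie in the span of the first [m] terms of [b] for some [m], and
   [psi m.+1] kills these terms. *)
have [m vm] : exists m, forall i, psi m.+1 (v i) = 0.
  have /choice[N vN] i := bP (v i); exists (\max_i N i) => i.
  have [d ->] := span_below_widen (leq_bigmax i) (vN i).
  rewrite (eq_bigr (fun j : 'I_ _ => d j *: b j)) => [|j _]; last first.
    exact: mulr_algl.
  by rewrite psi_lin big1 // => j _; rewrite psi_b ?mulr0.
have [_ _ [x lx]] := lP m.
(* Modulo [I], [x] is a combination of the [v i], so [psi m.+1] should vanish at [x], but [lx] makes
   it 1. *)
have [d /(_ m 1 1)] := vP x; rewrite mul1r mulr1 -scaleN1r psiD psiZ psi_lin.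
rewrite big1 => [|i _]; last by rewrite vm mulr0.
rewrite mulr0 addr0 /psi /= lx -(rmorph1 iota) phik => /eqP.
by rewrite oner_eq0.
Qed.

Theorem theorem1p5 (k : closedFieldType) (A : algType k)
  (k_uncountable : ~ exists e : nat -> k, forall x : k, exists n, e n = x)
  (A_ji : just_infinite A) (A_cg : countably_generated A) :
  stably_just_infinite A.
Proof.
split=> // K iota B f ext; split.
  by apply: (scalar_extension_infinite_dim ext); case: A_ji.
by move=> J; apply: (scalar_extension_finite_codim k_uncountable A_ji A_cg ext).
Qed.
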